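(* Let $H$ be a uniformly random directed hypergraph with degree sequence $((d_v^{\mathrm{out}},d_v^{\mathrm{in}})_{v\in V},(\delta_e^{\mathrm{tail}},\delta_e^{\mathrm{head}})_{e\in E})$, where $n=|V|$, and let $S_n$ be its number of self-loops. Let $E^* = \{e \in E: \delta_e^{\mathrm{tail}} = \delta_e^{\mathrm{head}}\}$ and write $\delta_e = \delta_e^{\mathrm{tail}}=\delta_e^{\mathrm{head}}$ for $e \in E^*$. Then $$\mathbb{E}[S_n] = \sum_{e \in E^*} \frac{(n\mathbb{E}[d_U^{\mathrm{in}}]-\delta_e)!\,(n\mathbb{E}[d_U^{\mathrm{out}}]-\delta_e)!}{(n\mathbb{E}[d_U^{\mathrm{in}}])!\,(n\mathbb{E}[d_U^{\mathrm{out}}])!} \sum_{\substack{\mathbf{a} \in \mathbb{N}^{\delta_e}:\\ \sum_{i=1}^{\delta_e} ia_i = \delta_e}} \frac{\delta_e!^2}{\prod_{k=1}^{\delta_e} k!^{2a_k} } \sum_{\alpha \in R(\mathbf{a})} (-1)^{\sum_{\mathbf{x} \in \mathbb{N}^{\delta_e}} (\sum_{i=1}^{\delta_e} x_i - 1)\alpha(\mathbf{x})}$$ $$\times\prod_{\mathbf{y} \in \mathbb{N}^{\delta_e}} \left( \frac{1}{\alpha(\mathbf{y})!} \left(\frac{n\,\mathbb{E}\left[\prod_{i=1}^{\delta_e} \left(\mathbf{1}_{\{d_U^{\mathrm{out}}\ge i,\ d_U^{\mathrm{in}} \geq i\}}\frac{d_U^{\mathrm{out}}!}{(d_U^{\mathrm{out}}-i)!}\frac{d_U^{\mathrm{in}}!}{(d_U^{\mathrm{in}}-i)!}\right)^{y_i}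 \right] \left(\sum_{i=1}^{\delta_e} y_i-1 \right)!}{\prod_{i=1}^{\delta_e} y_i!} \right)^{\alpha(\mathbf{y})} \right).$$
   Context: $\mathbb{N}$ contains $0$, and $0^0=1$. Let $V$ be a finite vertex set with $n=|V|$ and $E$ a finite set of (labelled) hyperedges. A directed degree sequence consists of vertex out- and in-degrees $d_v^{\mathrm{out}},d_v^{\mathrm{in}}\in\mathbb{N}$ ($v\in V$) and hyperedge tail- and head-degrees $\delta_e^{\mathrm{tail}},\delta_e^{\mathrm{head}}\in\mathbb{N}$ ($e\in E$) with $\sum_v d_v^{\mathrm{out}}=\sum_e\delta_e^{\mathrm{tail}}$ and $\sum_v d_v^{\mathrm{in}}=\sum_e\delta_e^{\mathrm{head}}$. A uniformly random (stub-labeled) directed hypergraph with this degree sequence is obtained as follows: each vertex $v$ has $d_v^{\mathrm{out}}$ distinguishable out-stubs and $d_v^{\mathrm{in}}$ distinguishable in-stubs; all out-stubs are distributed over the tails so that the tail of $e$ receives exactly $\delta_e^{\mathrm{tail}}$ out-stubs, and all in-stubs are distributed over the heads so that the head of $e$ receives exactly $\delta_e^{\mathrm{head}}$ in-stubs (slots within a tail or head are interchangeable); all such pairs of assignments are equally likely (so the out- and in-assignments are independent and uniform). Each hyperedge is then a pair $e=(e^{\mathrm{tail}},e^{\mathrm{head}})$ of multisets of vertices, where multiplicities count the stubs of a vertex in the tail and in the head. A hyperedge $e$ is a self-loop if $e^{\mathrm{tail}}=e^{\mathrm{head}}$ as multisets; $S_n$ is the number of self-loops. $U$ is a uniformly chosen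 vertex of $V$, with out-degree $d_U^{\mathrm{out}}$ and in-degree $d_U^{\mathrm{in}}$. For $\delta\in\mathbb{N}$ and $\mathbf{a}\in\mathbb{N}^{\delta}$, $R(\mathbf{a})$ is the set of functions $\alpha:\mathbb{N}^{\delta}\to\mathbb{N}$ with $\alpha(\mathbf{0})=0$ and $\sum_{\mathbf{x}\in\mathbb{N}^{\delta}}x_i\,\alpha(\mathbf{x})=a_i$ for all $i\in\{1,\dots,\delta\}$. Factors of the product with $\alpha(\mathbf{y})=0$ (in particular $\mathbf{y}=\mathbf{0}$) are equal to $1$, and the indicator times the quotients is $0$ when the indicator is $0$. *)

(* Defs.v *)
From HB Require Import structures.
From mathcomp Require Import all_boot all_order all_algebra.
From mathcomp Require Import finmap multiset.
From mathcomp Require Import all_classical all_reals esum.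

Set Implicit Arguments.
Unset Strict Implicit.
Unset Printing Implicit Defensive.

Import Order.TTheory GRing.Theory Num.Theory.
Local Open Scope mset_scope.
Local Open Scope ring_scope.

Record degree_sequence (V E : finType) := DegreeSequence {
  dout : V -> nat;
  din : V -> nat;
  dtail : E -> nat;
  dhead : E -> nat;
  sum_dout : (\sum_v dout v = \sum_e dtail e)%N;
  sum_din : (\sum_v din v = \sum_e dhead e)%N
}.

Section Stubs.
Variables V E : finType.

(* The d v distinguishable stubs of each vertex v; [tag] is the owner. *)
Definition stub (d : V -> nat) : finType := {v : V & 'I_(d v)}.

(* Slots within a side of a hyperedge are interchangeable, so a distribution
   of the stubs only records which hyperedge each stub goes to. *)
Definition distributions (d : V -> nat) (delta : E -> nat) :
    {set {ffun stub d -> E}} :=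
  [set f : {ffun stub d -> E} | [forall e, #|f @^-1: [set e]| == delta e]].

Definition owners (d : V -> nat) (f : {ffun stub d -> E}) (e : E) : {mset V} :=
  seq_mset [seq tag s | s in f @^-1: [set e]].

(* Each hyperedge is the pair (tail, head). *)
Definition dhypergraph := {ffun E -> {mset V} * {mset V}}.

Definition self_loop (H : dhypergraph) : pred E := fun e => (H e).1 == (H e).2.

Definition nb_self_loops (H : dhypergraph) : nat := #|self_loop H|.

Variable D : degree_sequence V E.

Definition stub_assignments :
    {set {ffun stub (dout D) -> E} * {ffun stub (din D) -> E}} :=
  finset.setX (distributions (dout D) (dtail D)) (distributions (din D) (dhead D)).

Definition hypergraph_of
    (w : {ffun stub (dout D) -> E} * {ffun stub (din D) -> E}) : dhypergraph :=
  [ffun e => (owners w.1 e, owners w.2 e)].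

End Stubs.

(* Expectation of X under the uniform distribution on the finite set A (the
   value is 0 if A is empty). *)
Definition unif_expect (R : realType) (T : finType) (A : {set T}) (X : T -> R) :
    R :=
  (\sum_(x in A) X x) / #|A|%:R.

(* The factorials of (n E[d_U] - delta) and n E[d_U] are written with Num.truncn
   since these numbers are natural (delta is one of the summands of the total
   degree n E[d_U]); the truncation is exact. *)
Lemma truncn_total_degree (R : realType) (V : finType) (d : V -> nat) :
  Num.truncn (#|V|%:R * unif_expect (R := R) [set: V] (fun u => (d u)%:R)) =
    (\sum_v d v)%N.
Proof.
rewrite /unif_expect cardsT.
under [in LHS]eq_bigl do rewrite finset.in_setT.
rewrite -natr_sum; have [V0|V0] := eqVneq #|V| 0%N; last first.
  by rewrite mulrC divfK ?pnatr_eq0// natrK.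
rewrite V0 mul0r big_pred0 ?truncn0// => v.
by have := card0_eq V0 v.
Qed.

(* R(a) for a in N^delta. The index i : 'I_delta stands for the integer i.+1.
   The sums over N^delta are taken in [0, +oo], so that only functions for
   which they converge are members. A member therefore has finite support, and
   R(a) is finite: sums over R(a), and sums and products over N^delta whose
   terms are trivial off the support of alpha, can be written with the
   finite-support operators \big[op/idx]_(i \in A), which would otherwise
   return idx. *)
Definition Rset (R : realType) (delta : nat) (a : {ffun 'I_delta -> nat}) :
    set ({ffun 'I_delta -> nat} -> nat) :=
  [set alpha | alpha [ffun=> 0%N] = 0%N /\
     forall i : 'I_delta,
       (\esum_(x in [set: {ffun 'I_delta -> nat}])
          ((x i * alpha x)%N%:R : R)%:E)%E = ((a i)%:R)%:E].

(* Main.v *)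
Require Import Defs.
From mathcomp Require Import all_boot all_order all_algebra fingroup perm.
From mathcomp Require Import finmap multiset.
From mathcomp Require Import all_classical all_reals esum.
From mathcomp Require Import zify ring.

Set Implicit Arguments.
Unset Strict Implicit.
Unset Printing Implicit Defensive.

Import Order.TTheory GRing.Theory Num.Theory.
Local Open Scope ring_scope.

(** By linearity it suffices to find the probability that a fixed hyperedge [e]
    is a self-loop, which vanishes unless tail and head have the same size
    delta.  The tail of [e] is a uniform set of delta out-stubs and its head an
    independent uniform set of delta in-stubs ([unif_expect_preim]); they give a
    loop when every vertex v owns the same number m_v of stubs in both.  Counting
    these pairs of sets vertex by vertex ([card_nb_stubs], [sum_nb_stubs_pair])
    gives, up to the factorials in front,
      sum over m with sum_v m_v = delta of prod_v C(dout v, m_v) C(din v, m_v).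

    Let a_k be the number of vertices with m_v = k, and f_k(v) the product of
    the k-th falling factorials of dout v and din v.  Grouping the m by a takes
    out the factor prod_k k!^(-2 a_k), and leaves the coefficient of t^a in
      F = prod_v (1 + sum_k f_k(v) t_k).
    The sum over R(a) is what comes out of writing F = exp(L), where
      L = sum_v log(1 + sum_k f_k(v) t_k) = sum_(y != 0) c_y p_y t^y,
      c_y = (-1)^(|y|-1) (|y|-1)! / prod_i y_i!,  p_y = sum_v prod_i f_i(v)^(y_i):
    expanding prod_y exp(c_y p_y t^y), the number alpha(y) is the exponent taken
    in the factor of y.

    No power series is needed.  The Euler operators t_j d/dt_j turn F = exp(L)
    into t_j dF/dt_j = (t_j dL/dt_j) F, that is, for coefficients,
      a_j X(a) = sum_(y <= a) y_j c_y p_y X(a - y)   for all j.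
    Together with X(0) = 1 this determines X by induction on the degree of a.
    The recursion is proved for the coefficients of the product in [sel_sum_rec]
    and for the sums over R(a) in [exp_sum_rec].  The latter only marks one of the
    exponents; the former also rests on the recursion [log_coef_rec] of the
    coefficients of the logarithm. *)

(** * Multi-indices *)

Section MultiIndices.
Variable I : finType.
Implicit Types a b y : {ffun I -> nat}.

Definition mdeg y : nat := (\sum_i y i)%N.
Definition mle y a := [forall i, y i <= a i]%N.
Definition msub a y : {ffun I -> nat} := [ffun i => a i - y i]%N.
Definition munit (k : I) : {ffun I -> nat} := [ffun i => (i == k) : nat].

(** A list rather than a finite set, as [{ffun I -> nat}] is infinite.  The bound
    [(mdeg a).+1] exceeds every entry of [a]. *)
Definition below a : seq {ffun I -> nat} :=
  [seq y <- [seq [ffun i => val (z i)] | z : {ffun I -> 'I_(mdeg a).+1}]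
     | mle y a].

Lemma leq_mdeg y i : (y i <= mdeg y)%N.
Proof. by rewrite /mdeg (bigD1 i)//= leq_addr. Qed.

Lemma mem_below a y : (y \in below a) = mle y a.
Proof.
rewrite mem_filter; case: (boolP (mle y a)) => //= /forallP ya.
apply/fintype.imageP; exists [ffun i => inord (y i)] => //.
by apply/ffunP => i; rewrite !ffunE inordK// ltnS (leq_trans (ya i))// leq_mdeg.
Qed.

Lemma below_uniq a : uniq (below a).
Proof.
apply/filter_uniq; rewrite map_inj_uniq ?enum_uniq// => z z' /ffunP zz'.
by apply/ffunP => i; apply/val_inj; have := zz' i; rewrite !ffunE.
Qed.

Lemma msub_unit_inj k y y' : (0 < y k)%N -> (0 < y' k)%N ->
  msub y (munit k) = msub y' (munit k) -> y = y'.
Proof.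
move=> yk y'k /ffunP yy'; apply/ffunP => i; have := yy' i.
by rewrite !ffunE; case: eqP => [->|_]; lia.
Qed.

(** Used to multiply by the variable t_k: the multi-indices with a positive
    k-th entry are those of the form z + e_k. *)
Lemma sum_below_shift (R : nmodType) b k (F : {ffun I -> nat} -> R) :
  (0 < b k)%N ->
  \sum_(y <- below (msub b (munit k))) F y =
  \sum_(y <- below b | (0 < y k)%N) F (msub y (munit k)).
Proof.
move=> bk; rewrite -[RHS]big_filter.
transitivity (\sum_(z <- map (msub^~ (munit k))
    [seq y : {ffun I -> nat} <- below b | (0 < y k)%N]) F z); last by rewrite big_map.
apply/perm_big/uniq_perm; first exact: below_uniq.
  rewrite map_inj_in_uniq ?(filter_uniq _ (below_uniq b))// => y y'.
  rewrite !mem_filter => /andP[yk _] /andP[y'k _].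
  exact: msub_unit_inj.
move=> y; rewrite mem_below; apply/idP/mapP => [/forallP yb|[z + ->]].
  exists [ffun i => (y i + munit k i)%N].
    rewrite mem_filter mem_below ffunE !ffunE eqxx addn1 /=; apply/forallP => i.
    by have := yb i; rewrite !ffunE; case: eqP => [->|_]; lia.
  by apply/ffunP => i; rewrite !ffunE addnK.
rewrite mem_filter mem_below => /andP[_ /forallP zb]; apply/forallP => i.
by rewrite !ffunE leq_sub2r.
Qed.

Lemma mdeg_eq0 y : mdeg y = 0%N -> y = [ffun=> 0%N].
Proof.
move=> /eqP; rewrite sum_nat_eq0 => /forallP y0; apply/ffunP => i.
by rewrite ffunE; apply/eqP/y0.
Qed.

Lemma mdeg_sub a y : mle y a -> (mdeg (msub a y) + mdeg y)%N = mdeg a.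
Proof.
move=> /forallP ya; rewrite -big_split/=; apply: eq_bigr => i _.
by rewrite ffunE subnK.
Qed.

Lemma mdeg_unit k : mdeg (munit k) = 1%N.
Proof.
rewrite /mdeg (bigD1 k)//= big1 ?ffunE ?eqxx// => i ik.
by rewrite ffunE (negbTE ik).
Qed.

Lemma mle_unit k y : mle (munit k) y = (0 < y k)%N.
Proof.
apply/forallP/idP => [/(_ k)|yk i]; first by rewrite ffunE eqxx.
by rewrite ffunE; case: eqP => [->|].
Qed.

Lemma mdeg_subS y k : (0 < y k)%N -> mdeg y = (mdeg (msub y (munit k))).+1.
Proof. by rewrite -mle_unit => /mdeg_sub <-; rewrite mdeg_unit addn1. Qed.

Lemma msubAC b y z : msub (msub b y) z = msub (msub b z) y.
Proof. by apply/ffunP => i; rewrite !ffunE subnAC. Qed.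

Lemma msubKunit b y k : (0 < y k)%N ->
  msub (msub b (munit k)) (msub y (munit k)) = msub b y.
Proof.
move=> yk; apply/ffunP => i; rewrite !ffunE.
by case: eqP => [->|_]; lia.
Qed.

Lemma fact_msub_unit y k : (0 < y k)%N ->
  (\prod_i (y i)`! = y k * \prod_i (msub y (munit k) i)`!)%N.
Proof.
move=> yk; rewrite (bigD1 k)//= [in RHS](bigD1 k)//= mulnA; congr (_ * _)%N.
  by rewrite !ffunE eqxx subn1; case: (y k) yk.
by apply: eq_bigr => i ik; rewrite !ffunE (negbTE ik) subn0.
Qed.

(** * The coefficients of the logarithm *)

Section LogCoefficient.
Variable R : numFieldType.

(** The coefficient of t^y in log (1 + sum_k t_k) for y != 0.  The value 1 at
    y = 0 is not that coefficient, but only the multiples [(y j)%:R * log_coef y]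
    occur in the recursions. *)
Definition log_coef y : R :=
  (-1) ^+ (mdeg y - 1) * (mdeg y - 1)`!%:R / (\prod_i (y i)`!)%:R.

(** For L = log (1 + sum_k t_k) this compares the coefficients of t^y in
    (1 + sum_k t_k) * (t_j dL/dt_j) = t_j.  In degree at least 2 it comes down to
    sum_k y_k (y_j - [k = j]) = y_j (|y| - 1). *)
Lemma log_coef_rec j y :
  (y j)%:R * log_coef y =
  (y == munit j)%:R -
    \sum_(k | (0 < y k)%N) (msub y (munit k) j)%:R * log_coef (msub y (munit k)).
Proof.
have factN0 (z : {ffun I -> nat}) : (\prod_i (z i)`!)%:R != 0 :> R.
  by rewrite pnatr_eq0 -lt0n prodn_gt0// => i; rewrite fact_gt0.
case: (posnP (mdeg y)) => [/mdeg_eq0 ->|y0].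
  rewrite ffunE mul0r big1 ?subr0; last by move=> k; rewrite ffunE.
  by case: eqP => // /(congr1 mdeg); rewrite mdeg_unit /mdeg big1// => i; rewrite ffunE.
have [y1|y1] := leqP (mdeg y) 1.
  have {y0 y1}y1 : mdeg y = 1%N by lia.
  rewrite big1 => [|k yk]; last first.
    have /mdeg_eq0 -> : mdeg (msub y (munit k)) = 0%N.
      by have := mdeg_subS yk; lia.
    by rewrite ffunE mul0r.
  rewrite subr0; have [yj|yj] := posnP (y j).
    rewrite yj mul0r; case: eqP => // yE.
    by move: yj; rewrite yE ffunE eqxx.
  have yE : y = munit j.
    apply/ffunP => i; have := mdeg_subS yj; rewrite y1 => -[/esym/mdeg_eq0] /ffunP.
    by move=> /(_ i); rewrite !ffunE; case: eqP => [->|_]; lia.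
  rewrite yE eqxx /log_coef mdeg_unit !ffunE eqxx big1 => [|i _].
    by rewrite expr0 invr1 !mulr1.
  by rewrite ffunE; case: eqP.
have -> : (y == munit j) = false.
  by apply/eqP => yE; move: y1; rewrite yE mdeg_unit.
(* All the terms are multiples of the same quotient of factorials. *)
have [d dE] : exists d, mdeg y = d.+2 by exists (mdeg y - 2)%N; lia.
rewrite sub0r (eq_bigr (fun k => (-1) ^+ d * d`!%:R / (\prod_i (y i)`!)%:R *
   (y k * msub y (munit k) j)%:R)) => [|k yk]; last first.
  have := mdeg_subS yk; rewrite dE => -[dE'].
  rewrite /log_coef -dE' subn1/= (fact_msub_unit yk) !natrM.
  have := factN0 (msub y (munit k)); have : (y k)%:R != 0 :> R.
    by rewrite pnatr_eq0 -lt0n.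
  by move=> ? ?; field; apply/andP.
rewrite -mulr_sumr -natr_sum.
have -> : (\sum_(k | 0 < y k) y k * msub y (munit k) j = y j * d.+1)%N.
  rewrite big_mkcond/= (eq_bigr (fun k => y k * (y j - (j == k)))%N); last first.
    by move=> k _; rewrite !ffunE; case: (y k).
  have [yj|yj] := posnP (y j); first by rewrite yj big1// => k _; rewrite sub0n muln0.
  have -> : d.+1 = (mdeg y - 1)%N by rewrite dE.
  rewrite /mdeg [X in _ = (_ * (X - 1))%N](bigD1 j)//= (bigD1 j)//= eqxx.
  rewrite (eq_bigr (fun k => y k * y j)%N) => [|k kj]; last first.
    by rewrite eq_sym (negbTE kj) subn0.
  by rewrite -big_distrl/=; nia.
rewrite /log_coef dE subn1/= exprS factS !natrM; ring.
Qed.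

End LogCoefficient.
End MultiIndices.

(** * Coefficients of a product over the vertices *)

Section Selections.
Variables (R : numFieldType) (V I : finType) (f : I -> V -> R).
Implicit Types (b y : {ffun I -> nat}) (m : {ffun V -> option I}).

(** A selection m takes one term from each factor of the product over v of
    1 + sum_k f_k(v) t_k, the term 1 being [None]; its type is the exponent of
    the resulting monomial. *)
Definition sel_type m : {ffun I -> nat} :=
  [ffun k => #|[set v | m v == Some k]%SET|].

Definition sel_weight m : R := \prod_v (if m v is Some k then f k v else 1).

(** The coefficient of t^b in the product over v of 1 + sum_k f_k(v) t_k. *)
Definition sel_sum b : R := \sum_(m | sel_type m == b) sel_weight m.

(** The part of that coefficient in which the factor of v contributes its term
    [o].  In particular [sel_sum_at v None] has the coefficients of the product
    over the other vertices. *)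
Definition sel_sum_at v o b : R :=
  \sum_(m | (sel_type m == b) && (m v == o)) sel_weight m.

Definition sel_set m v o : {ffun V -> option I} :=
  [ffun u => if u == v then o else m u].

Lemma sel_type_set m v k : m v = None ->
  forall i, sel_type (sel_set m v (Some k)) i = (sel_type m i + munit k i)%N.
Proof.
move=> mv i; rewrite !ffunE -!sum1dep_card big_mkcond [in RHS]big_mkcond.
rewrite (bigD1 v)//= [in RHS](bigD1 v)//= !ffunE eqxx mv /= add0n addnC.
congr (_ + _)%N; last by rewrite (inj_eq Some_inj) eq_sym; case: (i == k).
by apply: eq_bigr => u uv; rewrite ffunE (negbTE uv).
Qed.

(** Replacing the selection at v by [None] is a bijection that lowers the type
    by e_k. *)
Lemma sel_sum_at_some v k b : (0 < b k)%N ->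
  sel_sum_at v (Some k) b = f k v * sel_sum_at v None (msub b (munit k)).
Proof.
move=> bk; rewrite /sel_sum_at mulr_sumr.
rewrite (reindex_onto (fun m => sel_set m v (Some k))
                      (fun m => sel_set m v None))/=; last first.
  move=> m /andP[_ /eqP mv]; apply/ffunP => u; rewrite !ffunE.
  by case: eqP => [->|].
apply: eq_big => [m|m /andP[/andP[_ _] /eqP mE]].
  apply/idP/idP => [/andP[/andP[/eqP bE _] /eqP mE]|/andP[/eqP bE /eqP mv]].
    have mv : m v = None by rewrite -mE ffunE eqxx.
    rewrite mv eqxx andbT; apply/eqP/ffunP => i.
    by rewrite -bE [RHS]ffunE sel_type_set// addnK.
  rewrite ffunE eqxx eqxx andbT; apply/andP; split; apply/eqP/ffunP => i.
    rewrite sel_type_set// bE !ffunE.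
    by case: eqP => [->|_]; rewrite ?subnK ?subn0 ?addn0.
  by rewrite !ffunE; case: eqP => [->|].
have mv : m v = None by rewrite -mE ffunE eqxx.
rewrite /sel_weight (bigD1 v)//= [in RHS](bigD1 v)//= ffunE eqxx mv mul1r.
by congr (_ * _); apply: eq_bigr => u uv; rewrite ffunE (negbTE uv).
Qed.

Lemma sel_sum_at_some0 v k b : b k = 0%N -> sel_sum_at v (Some k) b = 0.
Proof.
move=> bk; rewrite /sel_sum_at big_pred0// => m; apply/negbTE/negP.
move=> /andP[/eqP bE /eqP mv]; move: bk; rewrite -bE ffunE => /eqP.
by rewrite cards_eq0 => /eqP/setP/(_ v); rewrite !inE mv eqxx.
Qed.

Lemma sel_sum_split v b :
  sel_sum b = sel_sum_at v None b + \sum_k sel_sum_at v (Some k) b.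
Proof.
rewrite /sel_sum (partition_big (fun m => m v) xpredT)//= (bigD1 None)//=.
congr (_ + _); rewrite (reindex_omap Some id)/= => [|[k|]//].
by apply: eq_bigl => k; rewrite eqxx.
Qed.

(** Let F be the product over all vertices, F' the product without v, and
    N_k = f_k(v) t_k F'.  Then F' = F - sum_k N_k and
    f_j(v) t_j N_k = f_k(v) t_k N_j, hence
    N_j = f_j(v) t_j F - sum_k f_k(v) t_k N_j. *)
Lemma sel_sum_at_rec v j b :
  sel_sum_at v (Some j) b =
  (if (0 < b j)%N then f j v * sel_sum (msub b (munit j)) else 0) -
  \sum_(k | (0 < b k)%N) f k v * sel_sum_at v (Some j) (msub b (munit k)).
Proof.
have [bj|bj] := posnP (b j).
  rewrite sel_sum_at_some0// big1 ?subr0// => k _.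
  by rewrite sel_sum_at_some0 ?mulr0// ffunE bj.
rewrite sel_sum_at_some// (sel_sum_split v) mulrDr.
suff -> : f j v * \sum_k sel_sum_at v (Some k) (msub b (munit j)) =
  \sum_(k | (0 < b k)%N) f k v * sel_sum_at v (Some j) (msub b (munit k)).
  by rewrite addrK.
rewrite mulr_sumr [RHS]big_mkcond; apply: eq_bigr => k _.
have [bk|bk] := posnP (b k).
  by rewrite sel_sum_at_some0 ?mulr0// ffunE bk.
have [->//|jk] := eqVneq j k.
rewrite !sel_sum_at_some ?ffunE ?(negbTE jk) 1?eq_sym ?(negbTE jk) ?subn0//.
by rewrite msubAC mulrCA.
Qed.

(** In the notation of [sel_sum_at_rec],
    N_j = f_j(v) t_j F / (1 + sum_k f_k(v) t_k) = (t_j dL_v/dt_j) F,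
    where L_v = log (1 + sum_k f_k(v) t_k).  The quotient of power series is
    replaced by an induction on the degree: both sides satisfy the recursion of
    [sel_sum_at_rec], the right-hand one by [log_coef_rec]. *)
Lemma sel_sum_at_log v j b :
  sel_sum_at v (Some j) b =
  \sum_(y <- below b)
     (y j)%:R * log_coef R y * \prod_i f i v ^+ y i * sel_sum (msub b y).
Proof.
have [d] := ubnP (mdeg b); elim: d b => // d IH b bd.
rewrite sel_sum_at_rec; under [RHS]eq_bigr do rewrite log_coef_rec !mulrBl.
rewrite sumrB; congr (_ - _).
  (* The term y = e_j occurs exactly when e_j <= b. *)
  rewrite (eq_bigr (fun y => if y == munit j then
      (\prod_i f i v ^+ y i * sel_sum (msub b y)) else 0)) => [|y _]; last first.
    by case: eqP => _; rewrite ?mul1r ?mul0r.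
  rewrite -big_mkcond -big_filter.
  rewrite (_ : [seq _ <- _ | _] = if (0 < b j)%N then [:: munit j] else [::]).
    case: ifP => _; rewrite ?big_nil// big_seq1 (bigD1 j)//= big1 => [|i ij].
      by rewrite ffunE eqxx mulr1.
    by rewrite ffunE (negbTE ij).
  rewrite -mle_unit -mem_below; case: ifP => bj.
    by rewrite filter_pred1_uniq ?below_uniq.
  by apply/eqP; rewrite -(negbK (_ == _)) -has_filter has_pred1 bj.
(* The induction hypothesis applies to b - e_k; the shift y := y + e_k turns its
   sum over multi-indices below b - e_k into one below b. *)
transitivity (\sum_(y <- below b) \sum_(k | (0 < y k)%N)
    (msub y (munit k) j)%:R * log_coef R (msub y (munit k)) *
    (\prod_i f i v ^+ y i) * sel_sum (msub b y)); last first.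
  by apply: eq_bigr => y _; rewrite !mulr_suml.
rewrite (exchange_big_dep xpredT)//= big_mkcond/=; apply: eq_bigr => k _.
case: ifPn => [bk|bk]; last first.
  rewrite big_seq_cond big1// => y; rewrite mem_below => /andP[/forallP/(_ k) yb yk].
  by move: bk; rewrite (leq_trans yk yb).
rewrite IH; last by rewrite (mdeg_subS bk) in bd.
rewrite mulr_sumr sum_below_shift//; apply: eq_bigr => y yk.
rewrite msubKunit// (bigD1 k)//= [in RHS](bigD1 k)//=.
rewrite (eq_bigr (fun i => f i v ^+ y i)) => [|i ik]; last first.
  by rewrite !ffunE (negbTE ik) subn0.
rewrite !ffunE eqxx -[in RHS](subnK yk) addn1 exprS; ring.
Qed.

(** A selection of type b selects j at b_j vertices, so b_j times the
    coefficient is the sum over v of the parts in which v selects j. *)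
Lemma sel_sum_rec j b :
  (b j)%:R * sel_sum b =
  \sum_(y <- below b)
     (y j)%:R * (log_coef R y * \sum_v \prod_i f i v ^+ y i) *
       sel_sum (msub b y).
Proof.
transitivity (\sum_v sel_sum_at v (Some j) b); last first.
  under eq_bigr do rewrite sel_sum_at_log.
  rewrite exchange_big; apply: eq_bigr => y _ /=.
  by rewrite -mulr_suml -mulr_sumr mulrA.
rewrite /sel_sum /sel_sum_at (exchange_big_dep (fun m => sel_type m == b))/=.
  rewrite mulr_sumr; apply: eq_bigr => m /eqP <-.
  rewrite sumr_const mulr_natl ffunE; congr (_ *+ _).
  by apply: eq_card => v; rewrite finset.inE unfold_in eqxx.
by move=> v m _ /andP[].
Qed.

Lemma sel_sum0 : sel_sum [ffun=> 0%N] = 1.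
Proof.
rewrite /sel_sum (big_pred1 [ffun=> None]) => [|m].
  by rewrite /sel_weight big1// => v _; rewrite ffunE.
apply/eqP/eqP => [/ffunP m0|->]; apply/ffunP.
  move=> v; rewrite ffunE.
  case mv: (m v) => [k|//]; have := m0 k; rewrite !ffunE => /eqP.
  by rewrite cards_eq0 => /eqP/setP/(_ v); rewrite !inE mv eqxx.
by move=> k; rewrite !ffunE; apply/eqP; rewrite cards_eq0;
  apply/eqP/setP => v; rewrite !inE ffunE.
Qed.
End Selections.

(** * Coefficients of an exponential as sums over R(a) *)

Lemma fsbigT_seq (S : Type) (idx : S) (op : Monoid.com_law idx)
    (T : choiceType) (s : seq T) (F : T -> S) :
  uniq s -> (forall x, x \notin s -> F x = idx) ->
  \big[op/idx]_(x \in [set: T]) F x = \big[op/idx]_(x <- s) F x.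
Proof.
move=> us F0; rewrite [RHS]fsbig_seq//; apply/esym.
by apply: fsbig_widen => // x [_ /negP/F0].
Qed.

Section ExponentialSum.
Variables (R : realType) (delta : nat).
Local Notation mindex := {ffun 'I_delta -> nat}.
Implicit Types (a y : mindex) (alpha : mindex -> nat).

(** If y_i > a_i, the term of y alone makes the i-th sum exceed a_i unless
    alpha(y) = 0. *)
Lemma Rset_support a alpha y : Rset R a alpha -> y \notin below a -> alpha y = 0%N.
Proof.
move=> [alpha0 alphaE]; rewrite mem_below => /forallPn[i]; rewrite -ltnNge => ai.
apply/eqP; rewrite -leqn0 leqNgt; apply/negP => y0.
have /esym : (\sum_(x \in [set y]%classic) ((x i * alpha x)%N%:R : R)%:E <=
  \esum_(x in [set: mindex]) ((x i * alpha x)%N%:R : R)%:E)%E.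
  apply: esum_ge; exists [set y]%classic => //; split => //; exact: finite_set1.
rewrite alphaE fsbig_set1 lee_fin ler_nat leqNgt => /esym/negP; apply.
by rewrite (leq_trans ai)// leq_pmulr.
Qed.

(** On functions with finite support the extended real sums become sums of
    natural numbers over any list that contains the support. *)
Lemma RsetP a alpha (s : seq mindex) :
  uniq s -> (forall y, y \notin s -> alpha y = 0%N) ->
  Rset R a alpha <->
  alpha [ffun=> 0%N] = 0%N /\ forall i, (\sum_(y <- s) y i * alpha y = a i)%N.
Proof.
move=> us alpha0.
suff E i : (\esum_(x in [set: mindex]) ((x i * alpha x)%N%:R : R)%:E =
    ((\sum_(y <- s) y i * alpha y)%N%:R)%:E)%E.
  split=> -[? H]; split=> // i; have := H i; rewrite ?E; last by move=> ->.
  by move=> [] /eqP; rewrite eqr_nat => /eqP.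
rewrite natr_sum -sumEFin fsbig_seq// -esum_fset => [|//|x _]; last first.
  by rewrite lee_fin.
rewrite [RHS]esum_mkcond; apply: eq_esum => x _; case: ifPn => //.
by rewrite mem_setE => /alpha0 ->; rewrite muln0.
Qed.

Lemma Rset_le a alpha y i : Rset R a alpha -> (y i * alpha y <= a i)%N.
Proof.
move=> Ra; have [yin|yin] := boolP (y \in below a); last first.
  by rewrite (Rset_support Ra yin) muln0.
have [_ /(_ i) <-] := (RsetP a (below_uniq a) (fun y => @Rset_support a alpha y Ra)).1 Ra.
by rewrite (bigD1_seq y) ?below_uniq//= leq_addr.
Qed.

Lemma Rset_bound a alpha y : Rset R a alpha -> (alpha y <= mdeg a)%N.
Proof.
move=> Ra; have [/mdeg_eq0 ->|] := posnP (mdeg y); first by case: Ra => ->.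
rewrite /mdeg lt0n sum_nat_eq0 => /forallPn[i yi].
rewrite (leq_trans _ (leq_mdeg a i))// (leq_trans _ (Rset_le y i Ra))//.
by rewrite leq_pmull// lt0n.
Qed.

(** The members of R(a) vanish outside the finite down-set of a and are bounded
    by the degree of a. *)
Lemma finite_Rset a : finite_set (Rset R a).
Proof.
pose T := {ffun seq_sub (below a) -> 'I_(mdeg a).+1}.
pose g (b : T) : mindex -> nat :=
  fun y => if insub y is Some s then val (b s) else 0%N.
apply: (@sub_finite_set _ _ (g @` [set: T])); last exact/finite_image/finite_finset.
move=> alpha Ra; exists [ffun s => inord (alpha (val s))] => //.
apply/funext => y; rewrite /g; case: insubP => [s _ <-|ya].
  by rewrite ffunE/= inordK// ltnS Rset_bound.
by rewrite (Rset_support Ra ya).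
Qed.

Variable w : mindex -> R.

(** The contribution of the exponents alpha to the product over y of
    exp (w_y t^y). *)
Definition exp_weight alpha : R :=
  \big[*%R/1]_(y \in [set: mindex]) ((alpha y)`!%:R^-1 * w y ^+ alpha y).

(** The coefficient of t^a in exp (sum_(y != 0) w_y t^y). *)
Definition exp_sum a : R := \sum_(alpha \in Rset R a) exp_weight alpha.

Definition incr y alpha : mindex -> nat := fun x => (alpha x + (x == y))%N.

Lemma exp_weight_seq alpha (s : seq mindex) :
  uniq s -> (forall y, y \notin s -> alpha y = 0%N) ->
  exp_weight alpha = \prod_(y <- s) ((alpha y)`!%:R^-1 * w y ^+ alpha y).
Proof.
move=> us alpha0; rewrite /exp_weight (fsbigT_seq _ us)// => x /alpha0 ->.
by rewrite invr1 mulr1.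
Qed.

Lemma exp_weight_incr alpha y (s : seq mindex) :
  uniq s -> (forall y, y \notin s -> alpha y = 0%N) -> y \in s ->
  (incr y alpha y)%:R * exp_weight (incr y alpha) = w y * exp_weight alpha.
Proof.
move=> us alpha0 ys; rewrite !(exp_weight_seq us)//; last first.
  by move=> x xs; rewrite /incr alpha0//; case: eqP xs => // ->; rewrite ys.
rewrite !(bigD1_seq y)//= /incr eqxx addn1 exprS factS natrM.
rewrite (eq_bigr (fun x => (alpha x)`!%:R^-1 * w x ^+ alpha x)) => [|x /negbTE ->].
  have : (alpha y)`!%:R != 0 :> R by rewrite pnatr_eq0 -lt0n fact_gt0.
  have : (alpha y).+1%:R != 0 :> R by rewrite pnatr_eq0.
  by move=> c0 f0; field; rewrite f0 addrC natr1.
by rewrite addn0.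
Qed.

(** Removing one copy of y lowers sum_x alpha(x) x, which is a on R(a), by y.  At
    y = 0 the bijection fails, since members of R(a) vanish there. *)
Lemma incr_bij a y : y \in below a -> y != [ffun=> 0%N] ->
  set_bij (Rset R (msub a y)) (Rset R a `&` [set alpha | (0 < alpha y)%N])%classic
    (incr y).
Proof.
move=> ya y0; have /forallP yle : mle y a by rewrite -mem_below.
have sub x : x \in below (msub a y) -> x \in below a.
  rewrite !mem_below => /forallP xa; apply/forallP => i; have := xa i.
  by rewrite ffunE => /leq_trans; apply; rewrite leq_subr.
have sum_incr alpha i : (\sum_(x <- below a) x i * incr y alpha x =
    \sum_(x <- below a) x i * alpha x + y i)%N.
  under eq_bigr do rewrite mulnDr; rewrite big_split/=; congr (_ + _)%N.
  rewrite (bigD1_seq y) ?below_uniq//= eqxx muln1 big1 ?addn0// => x /negbTE ->.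
  by rewrite muln0.
split.
- move=> alpha Ra; split; last by rewrite /= /incr eqxx addn1.
  have alpha0 x : x \notin below a -> alpha x = 0%N.
    by move=> xa; apply: (Rset_support Ra); apply: contra xa; exact: sub.
  have [a0 sa] := (RsetP _ (below_uniq a) alpha0).1 Ra.
  apply/(RsetP _ (below_uniq a)).
    by move=> x xs; rewrite /incr alpha0//; case: eqP xs => // ->; rewrite ya.
  split; first by rewrite /incr a0 eq_sym (negbTE y0).
  by move=> i; rewrite sum_incr sa ffunE subnK.
- move=> alpha beta _ _ /funeqP ab; apply/funext => x; have := ab x.
  by rewrite /incr => /addIn.
- move=> alpha [Ra /= ay].
  pose beta : mindex -> nat := fun x => (alpha x - (x == y))%N.
  have betaK : incr y beta = alpha.
    apply/funext => x; rewrite /incr /beta; case: eqP => [->|_].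
      by rewrite subnK.
    by rewrite subn0 addn0.
  exists beta => //.
  have beta0 x : x \notin below a -> beta x = 0%N.
    by move=> /(Rset_support Ra); rewrite /beta => ->.
  have [a0 sa] := (RsetP _ (below_uniq a) (fun y => @Rset_support a alpha y Ra)).1 Ra.
  apply/(RsetP _ (below_uniq a)) => //; split; first by rewrite /beta a0.
  by move=> i; rewrite ffunE -sa -betaK sum_incr addnK.
Qed.

(** Write a_j as the sum of the y_j alpha(y): this marks one of the alpha(y)
    copies of y.  Removing the marked copy gives a member of R(a - y), and
    alpha(y) w^alpha(y) / alpha(y)! = w * w^(alpha(y)-1) / (alpha(y)-1)!. *)
Lemma exp_sum_rec j a :
  (a j)%:R * exp_sum a =
  \sum_(y <- below a) (y j)%:R * w y * exp_sum (msub a y).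
Proof.
have step y : y \in below a -> (y j)%:R * w y * exp_sum (msub a y) =
    \sum_(alpha \in Rset R a) (y j * alpha y)%:R * exp_weight alpha.
  move=> ya; have [yj|yj] := posnP (y j).
    by rewrite yj !mul0r fsbig1// => alpha _; rewrite mul0n mul0r.
  have y0 : y != [ffun=> 0%N].
    by apply: contraTneq yj => ->; rewrite ffunE.
  rewrite -(fsbig_widen (Rset R a `&` [set alpha | (0 < alpha y)%N])%classic); last 2 first.
  - by move=> ? [].
  - move=> alpha [Ra]; rewrite /= => /not_andP[//|/negP].
    by rewrite -leqNgt leqn0 => /eqP ->; rewrite muln0 mul0r.
  rewrite (reindex_fsbig _ _ _ _ (incr_bij ya y0)) /exp_sum mulr_fsumr.
  apply: eq_fsbigr => alpha; rewrite inE => Ra.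
  rewrite natrM -!mulrA; congr (_ * _); apply/esym.
  apply: (@exp_weight_incr _ _ (below a)) => //; first exact: below_uniq.
  move=> x xa; apply: (Rset_support Ra); apply: contra xa.
  rewrite !mem_below => /forallP xa; apply/forallP => i; have := xa i.
  by rewrite ffunE => /leq_trans; apply; rewrite leq_subr.
rewrite (eq_big_seq _ step) {step}.
under [RHS]eq_bigr do rewrite (fsbig_finite _ _ (finite_Rset a)).
rewrite exchange_big /exp_sum mulr_fsumr (fsbig_finite _ _ (finite_Rset a))/=.
apply: eq_big_seq => alpha; rewrite in_fset_set ?inE; last exact: finite_Rset.
move=> Ra; rewrite -mulr_suml -natr_sum.
by have [_ ->] := (RsetP _ (below_uniq a) (fun y => @Rset_support a alpha y Ra)).1 Ra.
Qed.

Lemma exp_sum0 : exp_sum [ffun=> 0%N] = 1.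
Proof.
rewrite /exp_sum (_ : Rset R _ = [set fun=> 0%N]%classic).
  by rewrite fsbig_set1 /exp_weight fsbig1// => y _; rewrite invr1 mulr1.
apply/seteqP; split => alpha; last first.
  move=> ->; split=> // i; rewrite esum1 ?ffunE// => x _.
  by rewrite muln0.
move=> Ra; apply/funext => y; apply/eqP; rewrite -leqn0.
rewrite (leq_trans (Rset_bound y Ra))// /mdeg big1// => i _.
by rewrite ffunE.
Qed.

End ExponentialSum.

(** The identity F = exp (log F) for coefficients.  If a_j > 0, the recursion
    for the index j expresses a_j times the coefficient at a by those of smaller
    degree, because the terms with y_j = 0 vanish. *)
Lemma sel_sum_exp_sum (R : realType) (delta : nat) (V : finType)
    (f : 'I_delta -> V -> R) (a : {ffun 'I_delta -> nat}) :
  sel_sum f a =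
  exp_sum (fun y => log_coef R y * \sum_v \prod_i f i v ^+ y i) a.
Proof.
have [d] := ubnP (mdeg a); elim: d a => // d IH a ad.
have [/mdeg_eq0 ->|] := posnP (mdeg a); first by rewrite sel_sum0 exp_sum0.
rewrite /mdeg lt0n sum_nat_eq0 => /forallPn[j aj].
have aj0 : (a j)%:R != 0 :> R by rewrite pnatr_eq0.
apply: (mulfI aj0); rewrite sel_sum_rec exp_sum_rec.
apply: eq_big_seq => y; rewrite mem_below => /mdeg_sub ya.
have [->|yj] := posnP (y j); first by rewrite !mul0r.
rewrite IH// -ltnS (leq_trans _ ad)// ltnS -ya -addn1 leq_add2l.
exact: leq_trans yj (leq_mdeg y j).
Qed.

(** * The stubs on one side of a hyperedge *)

(** List the elements of each set, followed by those of its complement, and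
    match the two lists position by position. *)
Lemma perm_of_eq_card (T : finType) (A B : {set T}) :
  #|A| = #|B| -> exists s : {perm T}, s @^-1: B = A.
Proof.
move=> AB; pose l (C : {set T}) := enum C ++ enum (~: C).
have ul C : uniq (l C).
  rewrite cat_uniq !enum_uniq andbT /=; apply/hasPn => x.
  by rewrite !mem_enum finset.in_setC.
have ml C x : x \in l C.
  by rewrite mem_cat !mem_enum finset.in_setC; case: (x \in C).
have sl C : size (l C) = #|T|.
  by rewrite -(cardsC C) size_cat -!cardE.
have lE (C : {set T}) x : (x \in C) = (index x (l C) < #|C|)%N.
  rewrite index_cat mem_enum cardE; case: ifP => [xC|_].
    by rewrite index_mem mem_enum.
  by apply/esym/negbTE; rewrite -leqNgt leq_addr.
pose h x := nth x (l B) (index x (l A)).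
have hlt x : (index x (l A) < size (l B))%N by rewrite sl -(sl A) index_mem.
have hi x : index (h x) (l B) = index x (l A) by rewrite index_uniq.
have h_inj : injective h.
  move=> x y /(congr1 (index^~ (l B))); rewrite !hi => /(congr1 (nth x (l A))).
  by rewrite !nth_index.
exists (perm h_inj); apply/setP => x.
by rewrite finset.inE permE [RHS]lE AB -hi -lE.
Qed.

Section UniformExpectation.
Variable R : realType.

Lemma unif_expect_pair (T U : finType) (A : {set T}) (B : {set U})
    (X : T -> U -> R) :
  unif_expect (finset.setX A B) (fun w => X w.1 w.2) =
  unif_expect A (fun t => unif_expect B (X t)).
Proof.
rewrite /unif_expect cardsX natrM invfM -mulr_suml mulrCA mulrC -mulrA mulrC.
rewrite mulrA -mulrA [_^-1 * _]mulrC mulrA; congr (_ / _ / _).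
rewrite pair_big_dep/=; apply: eq_bigl => -[t u].
by rewrite finset.in_setX.
Qed.

Lemma unif_expect_sum (T : finType) (J : finType) (P : pred J) (A : {set T})
    (X : J -> T -> R) :
  unif_expect A (fun t => \sum_(j | P j) X j t) =
  \sum_(j | P j) unif_expect A (X j).
Proof. by rewrite /unif_expect exchange_big/= mulr_suml. Qed.

Lemma eq_unif_expect (T : finType) (A : {set T}) (X Y : T -> R) :
  {in A, X =1 Y} -> unif_expect A X = unif_expect A Y.
Proof. by move=> XY; congr (_ / _); apply: eq_bigr => t /XY. Qed.

End UniformExpectation.

Section Distributions.
Variables (V E : finType) (d : V -> nat) (delta : E -> nat).

Lemma card_stub : #|stub d| = (\sum_v d v)%N.
Proof.
rewrite card_tagged sumnE big_map big_enum.
by apply: eq_bigr => v _; rewrite card_ord.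
Qed.

Lemma card_stub_fibre v : #|[set s : stub d | tag s == v]%SET| = d v.
Proof.
pose g (i : 'I_(d v)) : stub d := Tagged (fun u => 'I_(d u)) i.
have g_inj : injective g by move=> i j /eqP; rewrite eq_Tagged => /eqP.
rewrite -[RHS]card_ord -[RHS]cardsT -(card_imset _ g_inj).
apply: eq_card => -[u i]; rewrite !inE /=; apply/eqP/imsetP => [uv|[j _ /(congr1 tag)]//].
by move: i; rewrite uv => i; exists i.
Qed.

(** The multiplicities of the multiset of owners of a set of stubs. *)
Definition nb_stubs (A : {set stub d}) : {ffun V -> nat} :=
  [ffun v => #|[set s in A | tag s == v]%SET|].

Lemma sum_nb_stubs A : (\sum_v nb_stubs A v)%N = #|A|.
Proof.
rewrite -sum1_card (partition_big (fun s : stub d => tag s) xpredT)//=.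
by apply: eq_bigr => v _; rewrite ffunE sum1dep_card.
Qed.

Lemma count_mem_owners (A : {set stub d}) v :
  count_mem v [seq tag s | s in A] = nb_stubs A v.
Proof.
by rewrite count_map -sum1_count big_enum_cond ffunE -sum1dep_card.
Qed.

(** A set of stubs is an independent choice of m_v among the d_v stubs of each
    vertex v. *)
Lemma card_nb_stubs (m : {ffun V -> nat}) :
  #|[set A | nb_stubs A == m]%SET| = (\prod_v 'C(d v, m v))%N.
Proof.
pose fibre v : {set stub d} := [set s | tag s == v]%SET.
pose F v : {pred {set stub d}} :=
  [set B : {set stub d} | (B \subset fibre v) && (#|B| == m v)]%SET.
pose split (A : {set stub d}) := [ffun v => A :&: fibre v]%SET.
have splitK : cancel split (fun h : {ffun V -> {set stub d}} => \bigcup_v h v)%SET.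
  move=> A; apply/setP => s; apply/bigcupP/idP => [[v _]|sA].
    by rewrite ffunE !inE => /andP[].
  by exists (tag s) => //; rewrite ffunE !inE sA eqxx.
rewrite -(card_imset _ (can_inj splitK)).
transitivity #|family F|.
  apply: eq_card => h; apply/imsetP/familyP => [[A + ->] v|hF].
    rewrite finset.inE => /eqP mE; rewrite !finset.inE !ffunE subsetIr /= -mE ffunE.
    apply/eqP.
    by apply: eq_card => s; rewrite !inE.
  have hE v s : s \in h v -> tag s = v.
    have := hF v; rewrite finset.inE => /andP[/fintype.subsetP + _] => /[apply].
    by rewrite finset.inE => /eqP.
  have hU v : (\bigcup_u h u) :&: fibre v = h v.
    apply/setP => s; rewrite !finset.inE; apply/andP/idP => [[/bigcupP[u _ su] /eqP <-]|sv].
      by rewrite (hE _ _ su).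
    by rewrite (hE _ _ sv) eqxx; split => //; apply/bigcupP; exists v.
  exists (\bigcup_v h v)%SET; last by apply/ffunP => v; rewrite ffunE hU.
  rewrite finset.inE; apply/eqP/ffunP => v; rewrite ffunE.
  have := hF v; rewrite finset.inE => /andP[_ /eqP <-]; rewrite -hU.
  by apply: eq_card => s; rewrite !finset.inE.
rewrite card_family foldrE big_map big_enum; apply: eq_bigr => v _.
by rewrite cards_draws card_stub_fibre.
Qed.

End Distributions.

Lemma owners_eqE (V E : finType) (d d' : V -> nat) (f : {ffun stub d -> E})
    (f' : {ffun stub d' -> E}) e :
  (owners f e == owners f' e) =
  (nb_stubs (f @^-1: [set e]) == nb_stubs (f' @^-1: [set e])).
Proof.
apply/eqP/eqP => [H|/ffunP H].
  by apply/ffunP => v; rewrite -!count_mem_owners -!mset_seqE -/(owners f e) H.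
by apply/eq_seq_msetP/allP => v _; apply/eqP; rewrite !count_mem_owners.
Qed.

(** The vertex stubs are matched with the slots of the hyperedges, which are the
    stubs for the function [delta]; there are equally many of both. *)
Lemma distributions_nonempty (V E : finType) (d : V -> nat) (delta : E -> nat) :
  (\sum_v d v = \sum_e delta e)%N -> (0 < #|distributions d delta|)%N.
Proof.
rewrite -!card_stub => eq_stubs.
pose g (s : stub d) : stub delta := enum_val (cast_ord eq_stubs (enum_rank s)).
have g_bij : bijective g.
  exists (fun t => enum_val (cast_ord (esym eq_stubs) (enum_rank t))) => s;
  by rewrite /g enum_valK ?cast_ordK ?cast_ordKV enum_rankK.
apply/card_gt0P; exists [ffun s => tag (g s)]; rewrite finset.inE.
apply/forallP => e; apply/eqP; rewrite -[RHS](card_stub_fibre delta).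
rewrite -(on_card_preimset (onW_bij _ g_bij)).
by apply: eq_card => s; rewrite !finset.inE ffunE.
Qed.

(** Any two sets of [delta e] stubs are exchanged by a permutation of the stubs,
    which also permutes the distributions.  So each of them is the set of stubs
    sent to e for the same number of distributions. *)
Lemma unif_expect_preim (R : realType) (V E : finType) (d : V -> nat)
    (delta : E -> nat) e (X : {set stub d} -> R) :
  (\sum_v d v = \sum_e delta e)%N ->
  unif_expect (distributions d delta) (fun f => X (f @^-1: [set e])) =
  unif_expect [set A : {set stub d} | #|A| == delta e]%SET X.
Proof.
move=> /distributions_nonempty dist_gt0.
pose D := distributions d delta.
pose C := [set A : {set stub d} | #|A| == delta e]%SET.
have [f0 f0D] := card_gt0P dist_gt0.
pose A0 := f0 @^-1: [set e].
pose K (A : {set stub d}) := #|[set f in D | f @^-1: [set e] == A]%SET|.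
have KE A : A \in C -> K A = K A0.
  have A0C : A0 \in C.
    by move: f0D; rewrite !finset.inE => /forallP/(_ e).
  rewrite finset.inE => /eqP cA; move: A0C; rewrite finset.inE => /eqP cA0.
  (* Precomposition with s is a bijection between the distributions that send
     A0 to e and those that send A to e. *)
  have [s sA] := perm_of_eq_card (etrans cA0 (esym cA)).
  pose tr (f : {ffun stub d -> E}) := [ffun x => f (s x)].
  have tr_pre f B : tr f @^-1: B = s @^-1: (f @^-1: B).
    by apply/setP => x; rewrite !finset.inE ffunE.
  have tr_inj : injective tr.
    move=> f g /ffunP fg; apply/ffunP => x.
    by have := fg (s^-1 x)%g; rewrite !ffunE permKV.
  rewrite /K -(card_imset _ tr_inj); apply: eq_card => g; rewrite [RHS]finset.inE.
  have preinj : injective (fun B : {set stub d} => s @^-1: B).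
    move=> B B' /setP BB; apply/setP => x.
    by have := BB (s^-1 x)%g; rewrite !finset.inE permKV.
  apply/imsetP/andP => [[f + ->]|[gD /eqP gA]].
    rewrite finset.inE => /andP[fD /eqP fA]; split; last first.
      by rewrite tr_pre fA sA.
    move: fD; rewrite !finset.inE => /forallP fD; apply/forallP => e'.
    by rewrite tr_pre card_preimset//; exact: perm_inj.
  have gE : g = tr [ffun x => g (s^-1 x)%g].
    by apply/ffunP => x; rewrite !ffunE permK.
  exists [ffun x => g (s^-1 x)%g] => //.
  rewrite !finset.inE; apply/andP; split.
    apply/forallP => e'; move: gD; rewrite finset.inE => /forallP/(_ e').
    by rewrite {1}gE tr_pre card_preimset//; exact: perm_inj.
  apply/eqP/preinj; rewrite -tr_pre -gE sA; exact: gA.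
have sumD (Y : {set stub d} -> R) :
    \sum_(f in D) Y (f @^-1: [set e]) = (K A0)%:R * \sum_(A in C) Y A.
  rewrite (partition_big (fun f : {ffun stub d -> E} => f @^-1: [set e]) (mem C)) /=.
    rewrite mulr_sumr; apply: eq_bigr => A AC.
    rewrite (eq_bigr (fun=> Y A)) => [|f /andP[_ /eqP ->]//].
    rewrite sumr_const -(KE _ AC) mulr_natl; congr (_ *+ _).
    by apply: eq_card => f; rewrite finset.inE.
  by move=> f; rewrite !finset.inE => /forallP/(_ e).
have K0 : (K A0)%:R != 0 :> R.
  rewrite pnatr_eq0 -lt0n; apply/card_gt0P; exists f0.
  by rewrite finset.inE f0D eqxx.
have cD : #|D|%:R = (K A0)%:R * #|C|%:R :> R.
  by have := sumD (fun=> 1); rewrite !sumr_const.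
by rewrite /unif_expect -/D -/C sumD cD -mulf_div divff// mul1r.
Qed.

(** * The probability of a self-loop *)

(** Collects the vertices by the index they select; [iterop] is the power of the
    operation. *)
Lemma big_sel_type (S : Type) (idx : S) (op : Monoid.com_law idx)
    (V I : finType) (m : {ffun V -> option I}) (g : I -> S) :
  \big[op/idx]_v (if m v is Some k then g k else idx) =
  \big[op/idx]_k iterop (sel_type m k) op (g k) idx.
Proof.
rewrite (eq_bigr (fun k => \big[op/idx]_(v | m v == Some k) g k)) => [|k _].
  rewrite (exchange_big_dep xpredT)//=; apply: eq_bigr => v _.
  case: (m v) => [k|]; last by rewrite big_pred0.
  by rewrite (big_pred1 k)// => i; rewrite eq_sym.
by rewrite big_const ffunE cardsE Monoid.iteropE.
Qed.

Section Coding.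
Variable delta : nat.

(** A multiplicity between 0 and delta, with the convention that the index
    i : 'I_delta stands for the integer i.+1.  Families of multiplicities thereby
    become selections, the vertices of multiplicity 0 selecting nothing. *)
Definition mult (o : option 'I_delta) : nat := if o is Some k then k.+1 else 0%N.

Definition mults (V : finType) (m : {ffun V -> option 'I_delta}) : {ffun V -> nat} :=
  [ffun v => mult (m v)].

Lemma sum_mults (V : finType) (m : {ffun V -> option 'I_delta}) :
  (\sum_v mults m v = \sum_(k < delta) k.+1 * sel_type m k)%N.
Proof.
under eq_bigr do rewrite ffunE.
rewrite (big_sel_type _ m (fun k : 'I_delta => k.+1)).
by apply: eq_bigr => k _; rewrite Monoid.iteropE iter_addn_0.
Qed.

Definition unmult (k : nat) : option 'I_delta :=
  if k is k'.+1 then insub k' else None.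

Lemma multK : cancel mult unmult.
Proof. by case=> [k|//] /=; rewrite valK. Qed.

Lemma unmultK k : (k <= delta)%N -> mult (unmult k) = k.
Proof. by case: k => [//|k] kd /=; rewrite insubT. Qed.

(** The multiplicities of a set of delta stubs are at most delta, so they are
    encoded by a selection, and [card_nb_stubs] counts the sets with given
    multiplicities. *)
Lemma sum_nb_stubs_eq (R : pzSemiRingType) (V : finType) (d : V -> nat)
    (F : {ffun V -> nat} -> R) :
  \sum_(A in [set A : {set stub d} | #|A| == delta]%SET) F (nb_stubs A) =
  \sum_(m : {ffun V -> option 'I_delta} | (\sum_v mults m v == delta)%N)
     (\prod_v 'C(d v, mults m v))%:R * F (mults m).
Proof.
pose code (A : {set stub d}) : {ffun V -> option 'I_delta} :=
  [ffun v => unmult (nb_stubs A v)].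
have codeK (A : {set stub d}) : #|A| = delta -> mults (code A) = nb_stubs A.
  move=> cA; apply/ffunP => v; rewrite !ffunE unmultK//.
  by rewrite -cA subset_leq_card//; apply/fintype.subsetP => s; rewrite finset.inE => /andP[].
rewrite (partition_big code (fun m => (\sum_v mults m v == delta)%N)) /=.
  apply: eq_bigr => m /eqP sm.
  rewrite -card_nb_stubs (eq_bigr (fun=> F (mults m))) => [|A /andP[]].
    rewrite sumr_const mulr_natl; congr (_ *+ _); apply: eq_card => A.
    rewrite unfold_in !finset.inE; apply/andP/eqP => [[/eqP /codeK <- /eqP ->//]|nA].
    rewrite -sum_nb_stubs nA sm eqxx; split => //; apply/eqP/ffunP => v.
    by rewrite ffunE nA ffunE multK.
  by rewrite finset.inE => /eqP /codeK <- /eqP ->.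
by move=> A; rewrite finset.inE => /eqP cA; rewrite codeK// sum_nb_stubs cA.
Qed.

Lemma mults_inj (V : finType) : injective (@mults V).
Proof.
move=> m m' /ffunP mm; apply/ffunP => v; have := mm v; rewrite !ffunE.
exact: can_inj multK _ _.
Qed.

Lemma sum_nb_stubs_pair (R : pzSemiRingType) (V : finType) (d d' : V -> nat) :
  \sum_(A in [set A : {set stub d} | #|A| == delta]%SET)
    \sum_(B in [set B : {set stub d'} | #|B| == delta]%SET)
      (nb_stubs A == nb_stubs B)%:R =
  \sum_(m : {ffun V -> option 'I_delta} | (\sum_v mults m v == delta)%N)
     \prod_v ('C(d v, mults m v) * 'C(d' v, mults m v))%:R :> R.
Proof.
rewrite (sum_nb_stubs_eq d (fun c => \sum_(B in _) (c == nb_stubs B)%:R)).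
apply: eq_bigr => m sm; rewrite (sum_nb_stubs_eq d' (fun c => (_ == c)%:R)).
rewrite (bigD1 m)//= eqxx mulr1 [X in _ + X]big1 ?addr0 => [|m' /andP[_]]; last first.
  by rewrite eq_sym -(inj_eq (@mults_inj V)) => /negbTE ->; rewrite mulr0.
by rewrite -natrM -big_split natr_prod.
Qed.

End Coding.

Lemma unif_expect_draws (R : realType) (T : finType) (k : nat) (X : {set T} -> R) :
  (k <= #|T|)%N ->
  unif_expect [set A : {set T} | #|A| == k]%SET X =
  k`!%:R * (#|T| - k)`!%:R / (#|T|)`!%:R * \sum_(A in [set A : {set T} | #|A| == k]%SET) X A.
Proof.
move=> kT; rewrite /unif_expect card_draws mulrC; congr (_ * _).
have /(congr1 (fun m => m%:R : R)) := bin_fact kT; rewrite !natrM => <-.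
have [? ? ?] : [/\ k`!%:R != 0 :> R, (#|T| - k)`!%:R != 0 :> R & 'C(#|T|, k)%:R != 0 :> R].
  by rewrite !pnatr_eq0 -!lt0n !fact_gt0 bin_gt0.
by field; apply/and3P.
Qed.

(** Tail and head are independent uniform sets of stubs, and they form a loop
    when their multiplicities agree.  The factors come from
    1 / C(N, delta) = delta! (N - delta)! / N!. *)
Lemma self_loop_expect (R : realType) (V E : finType) (D : degree_sequence V E)
    (e : E) : dtail D e = dhead D e ->
  let delta := dtail D e in
  let dO := (\sum_v dout D v)%N in let dI := (\sum_v din D v)%N in
  unif_expect (stub_assignments D)
    (fun w => (self_loop (hypergraph_of w) e)%:R : R) =
  ((dI - delta)`! * (dO - delta)`!)%N%:R / (dI`! * dO`!)%N%:R * (delta`! ^ 2)%N%:R *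
  \sum_(m : {ffun V -> option 'I_delta} | (\sum_v mults m v == delta)%N)
     \prod_v ('C(dout D v, mults m v) * 'C(din D v, mults m v))%:R.
Proof.
move=> eE delta dO dI.
have dOle : (delta <= dO)%N by rewrite /dO sum_dout (bigD1 e)//= leq_addr.
have dIle : (delta <= dI)%N by rewrite /dI sum_din /delta eE (bigD1 e)//= leq_addr.
under eq_unif_expect => w _.
  rewrite /self_loop !ffunE/= owners_eqE; over.
rewrite /stub_assignments (unif_expect_pair _ _
  (fun (f : {ffun stub (dout D) -> E}) (g : {ffun stub (din D) -> E}) =>
  (nb_stubs (f @^-1: [set e]) == nb_stubs (g @^-1: [set e]))%:R)).
under eq_unif_expect => f _.
  rewrite (unif_expect_preim e (fun B => (nb_stubs (f @^-1: [set e]) == nb_stubs B)%:R)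
     (sum_din D)); over.
rewrite (unif_expect_preim e (fun A => unif_expect _ (fun B => (nb_stubs A == nb_stubs B)%:R))
  (sum_dout D)).
rewrite -/delta -eE -/delta unif_expect_draws card_stub//.
under [X in _ * X = _]eq_bigr do rewrite unif_expect_draws card_stub//.
rewrite -mulr_sumr sum_nb_stubs_pair mulrA; congr (_ * _).
rewrite -/dO -/dI !natrM; field.
by rewrite !pnatr_eq0 -!lt0n !fact_gt0.
Qed.

(** Multisets of different sizes are different. *)
Lemma self_loop_expect0 (R : realType) (V E : finType) (D : degree_sequence V E)
    (e : E) : dtail D e != dhead D e ->
  unif_expect (stub_assignments D)
    (fun w => (self_loop (hypergraph_of w) e)%:R : R) = 0.
Proof.
move=> eE; rewrite /unif_expect big1 ?mul0r// => -[f g].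
rewrite finset.in_setX !finset.inE /= => /andP[/forallP/(_ e)/eqP fe /forallP/(_ e)/eqP ge].
rewrite /self_loop !ffunE/= owners_eqE; case: eqP => // /ffunP H.
by move: eE; rewrite -fe -ge -!sum_nb_stubs; under eq_bigr do rewrite H; rewrite eqxx.
Qed.

Section Grouping.
Variables (R : realType) (V : finType) (delta : nat) (dO dI : V -> nat).

Definition common_falling (k : 'I_delta) (v : V) : R :=
  ((k.+1 <= dO v)%N && (k.+1 <= dI v)%N)%:R *
  ((dO v)`!%:R / (dO v - k.+1)`!%N%:R) *
  ((dI v)`!%:R / (dI v - k.+1)`!%N%:R).

Lemma bin_common_falling (k : 'I_delta) v :
  ('C(dO v, k.+1) * 'C(dI v, k.+1))%:R =
  ((k.+1)`! ^ 2)%:R^-1 * common_falling k v.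
Proof.
have binE n : (k.+1 <= n)%N ->
    'C(n, k.+1)%:R = (k.+1)`!%:R^-1 * (n`!%:R / (n - k.+1)`!%:R) :> R.
  move=> /bin_fact <-; have := fact_gt0 k.+1; have := fact_gt0 (n - k.+1).
  move: (k.+1)`! (n - k.+1)`! => x y y0 x0; rewrite !natrM.
  by field; rewrite !pnatr_eq0 -!lt0n x0 y0.
rewrite /common_falling natrM; have [kO|kO] := leqP k.+1 (dO v); last first.
  by rewrite bin_small// !mul0r mulr0.
have [kI|kI] := leqP k.+1 (dI v); last by rewrite (bin_small kI) !mul0r !mulr0.
rewrite !binE// mul1r natrX -exprVn expr2; move: _%:R^-1 (_ / _) (_ / _) => x y z; ring.
Qed.

(** By C(n, k) = n! / (k! (n - k)!), a vertex of multiplicity k contributes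
    f_k(v) / k!^2, and the type of m counts these vertices. *)
Lemma prod_bin_sel (m : {ffun V -> option 'I_delta}) :
  \prod_v ('C(dO v, mults m v) * 'C(dI v, mults m v))%:R =
  (\prod_(i < delta) (i.+1)`! ^ (2 * sel_type m i))%N%:R^-1 *
  sel_weight common_falling m.
Proof.
rewrite (eq_bigr (fun v => (if m v is Some k then ((k.+1)`! ^ 2)%:R^-1 else 1) *
    (if m v is Some k then common_falling k v else 1))) => [|v _].
  rewrite big_split (big_sel_type _ m (fun k : 'I_delta => ((k.+1)`! ^ 2)%:R^-1)) /=.
  congr (_ * _); rewrite natr_prod -prodfV; apply: eq_bigr => i _.
  by rewrite -[LHS]/(_ ^+ _) exprVn -natrX expnM.
rewrite ffunE; case: (m v) => [k|] /=; first exact: bin_common_falling.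
by rewrite !bin0 mulr1.
Qed.

(** Each entry of such a multi-index is at most delta. *)
Lemma finite_sel_types : finite_set [set a : {ffun 'I_delta -> nat} |
  (\sum_(i < delta) i.+1 * a i)%N = delta].
Proof.
apply: (@sub_finite_set _ _ [set` below [ffun=> delta]]); last exact: finite_seq.
move=> a /= aE; rewrite mem_below; apply/forallP => i; rewrite ffunE -[X in (_ <= X)%N]aE.
by rewrite (bigD1 i)//= (leq_trans _ (leq_addr _ _))// leq_pmull.
Qed.

(** Groups the selections by type.  By [finite_sel_types] the sum over types
    has finite support, whatever [F] is. *)
Lemma sum_sel_type (F : {ffun 'I_delta -> nat} -> R)
    (f : 'I_delta -> V -> R) :
  \sum_(m : {ffun V -> option 'I_delta} | (\sum_v mults m v == delta)%N)
     F (sel_type m) * sel_weight f m =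
  \sum_(a \in [set a : {ffun 'I_delta -> nat} |
                  (\sum_(i < delta) i.+1 * a i)%N = delta]) F a * sel_sum f a.
Proof.
rewrite (fsbig_finite _ _ finite_sel_types)/=.
under [RHS]eq_bigr do rewrite mulr_sumr.
rewrite [RHS](exchange_big_dep xpredT)//= big_mkcond; apply: eq_bigr => m _.
rewrite sum_mults.
rewrite (eq_bigr (fun=> F (sel_type m) * sel_weight f m)) => [|a /eqP ->//].
rewrite -big_filter.
rewrite (_ : [seq _ <- _ | _] = if (\sum_(i < delta) i.+1 * sel_type m i == delta)%N
   then [:: sel_type m] else [::]).
  by case: ifP => _; rewrite ?big_seq1 ?big_nil.
under eq_filter do rewrite eq_sym.
case: ifPn => [/eqP mE|mE].
  rewrite filter_pred1_uniq ?fset_uniq// in_fset_set ?inE//.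
  exact: finite_sel_types.
apply/eqP; rewrite -(negbK (_ == _)) -has_filter has_pred1 in_fset_set.
  by rewrite notin_setE => /eqP; apply/negP.
exact: finite_sel_types.
Qed.

End Grouping.

(** The sign is distributed over the factors: alpha(y) copies of (-1)^(|y|-1)
    make up the sign of [log_coef].  At y = 0 the exponent is multiplied by
    alpha(0) = 0, which hides that |y| - 1 is negative as an integer and
    truncated to 0 as a natural number. *)
Lemma signed_exp_weight (R : realType) (delta : nat)
    (p : {ffun 'I_delta -> nat} -> R) a alpha : Rset R a alpha ->
  (-1) ^ (\sum_(x \in [set: {ffun 'I_delta -> nat}])
                    ((\sum_(i < delta) x i)%N%:Z - 1) * (alpha x)%:Z) *
          \big[*%R/1]_(y \in [set: {ffun 'I_delta -> nat}])
            (((alpha y)`!)%:R^-1 *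
             (p y * ((\sum_(i < delta) y i) - 1)`!%N%:R
              / (\prod_(i < delta) (y i)`!)%N%:R) ^+ alpha y) =
  exp_weight (fun y => log_coef R y * p y) alpha.
Proof.
move=> Ra; have us := below_uniq a.
have alpha0 y : y \notin below a -> alpha y = 0%N by exact: (Rset_support Ra).
rewrite (exp_weight_seq _ us alpha0) !(fsbigT_seq _ us); last 2 first.
- by move=> x /alpha0 ->; rewrite expr0 invr1 mulr1.
- by move=> x /alpha0 ->; rewrite mulr0.
have -> : (-1) ^ (\sum_(x <- below a) ((\sum_(i < delta) x i)%N%:Z - 1) * (alpha x)%:Z) =
    \prod_(x <- below a) ((-1) ^+ (mdeg x - 1)) ^+ alpha x :> R.
  elim: (below a) => [|x s IH]; first by rewrite !big_nil.
  rewrite !big_cons expfzDr ?oppr_eq0 ?oner_eq0// IH; congr (_ * _).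
  rewrite -[(\sum_(i < delta) x i)%N]/(mdeg x).
  have [/mdeg_eq0 x0|x0] := posnP (mdeg x).
    by rewrite x0 (proj1 Ra) mulr0 expr0.
  by rewrite -exprM subzn// -PoszM.
rewrite -big_split; apply: eq_bigr => y _ /=.
rewrite /log_coef -/(mdeg y) mulrCA -exprMn; congr (_ * _ ^+ _); ring.
Qed.

(** * The expected number of self-loops *)

Lemma nb_self_loopsE (R : realType) (V E : finType) (H : dhypergraph V E) :
  (nb_self_loops H)%:R = \sum_e (self_loop H e)%:R :> R.
Proof.
rewrite /nb_self_loops -sum1_card big_mkcond natr_sum; apply: eq_bigr => e _.
by rewrite unfold_in [in RHS]/self_loop; case: eqP.
Qed.

Theorem theorem5 (R : realType) (V E : finType) (D : degree_sequence V E) :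
  let n : R := #|V|%:R in
  let EU (X : V -> R) : R := unif_expect [set: V] X in
  let nEin : R := n * EU (fun u => (din D u)%:R) in
  let nEout : R := n * EU (fun u => (dout D u)%:R) in
  unif_expect (stub_assignments D)
    (fun w => (nb_self_loops (hypergraph_of w))%:R) =
  \sum_(e : E | dtail D e == dhead D e)
    let delta := dtail D e in
    ((Num.truncn (nEin - delta%:R))`! * (Num.truncn (nEout - delta%:R))`!)%N%:R
      / ((Num.truncn nEin)`! * (Num.truncn nEout)`!)%N%:R *
    \sum_(a \in [set a : {ffun 'I_delta -> nat} |
                  (\sum_(i < delta) i.+1 * a i)%N = delta])
      ((delta`! ^ 2)%N%:R / (\prod_(i < delta) (i.+1)`! ^ (2 * a i))%N%:R *
       \sum_(alpha \in Rset R a)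
         ((-1) ^ (\sum_(x \in [set: {ffun 'I_delta -> nat}])
                    ((\sum_(i < delta) x i)%N%:Z - 1) * (alpha x)%:Z) *
          \big[*%R/1]_(y \in [set: {ffun 'I_delta -> nat}])
            (((alpha y)`!)%:R^-1 *
             (n * EU (fun u =>
                  \prod_(i < delta)
                    (((i.+1 <= dout D u)%N && (i.+1 <= din D u)%N)%:R *
                     ((dout D u)`!%:R / (dout D u - i.+1)`!%N%:R) *
                     ((din D u)`!%:R / (din D u - i.+1)`!%N%:R)) ^+ y i) *
              ((\sum_(i < delta) y i) - 1)`!%N%:R
              / (\prod_(i < delta) (y i)`!)%N%:R) ^+ alpha y))).
Proof.
move=> n EU nEin nEout.
have nEU (X : V -> R) : n * EU X = \sum_v X v.
  rewrite /n /EU /unif_expect cardsT.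
  under eq_bigl do rewrite finset.in_setT.
  have [V0|V0] := eqVneq #|V| 0%N; last by rewrite mulrC divfK ?pnatr_eq0.
  by rewrite V0 mul0r big_pred0// => v; have := card0_eq V0 v.
have nEinE : nEin = (\sum_v din D v)%N%:R by rewrite /nEin nEU natr_sum.
have nEoutE : nEout = (\sum_v dout D v)%N%:R by rewrite /nEout nEU natr_sum.
under eq_unif_expect do rewrite nb_self_loopsE.
rewrite unif_expect_sum [RHS]big_mkcond; apply: eq_bigr => e _.
case: ifPn => [/eqP eE|]; last exact: self_loop_expect0.
rewrite self_loop_expect//=.
have dOle : (dtail D e <= \sum_v dout D v)%N by rewrite sum_dout (bigD1 e)//= leq_addr.
have dIle : (dtail D e <= \sum_v din D v)%N by rewrite sum_din eE (bigD1 e)//= leq_addr.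
rewrite nEinE nEoutE -!natrB// !natrK -mulrA; congr (_ * _).
under eq_bigr do rewrite prod_bin_sel.
rewrite (sum_sel_type (fun a => (\prod_(i < dtail D e) (i.+1)`! ^ (2 * a i))%N%:R^-1)).
rewrite mulr_fsumr; apply: eq_fsbigr => a _; rewrite -[in RHS]mulrA.
congr (_ * (_ * _)); rewrite sel_sum_exp_sum /exp_sum.
apply: eq_fsbigr => alpha; rewrite inE => Ra.
rewrite -(signed_exp_weight _ Ra); congr (_ * _).
by apply: eq_fsbigr => y _; rewrite nEU.
Qed.
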